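(* Let $K$ and $M$ be origin-symmetric star bodies in $\mathbb{R}^n$, and let $f\ge 0$ be an even continuous function on $\mathbb{R}^n$. Given a real $p\ge 1$, suppose that for every $\xi\in S^{n-1}$ $$\int_K|(x,\xi)|^p f(x)\,dx\;\le\;\int_M|(x,\xi)|^p f(x)\,dx.$$ Then $$\int_K f(x)\,dx\;\le\; d_{BM}^{\,p}(M,L_p^n)\int_M f(x)\,dx.$$
   Context: $(x,y)$ is the standard scalar product in $\mathbb{R}^n$ and $S^{n-1}$ the Euclidean unit sphere centered at the origin. A star body is a compact set in $\mathbb{R}^n$, star-shaped with respect to the origin, with the origin in its interior, whose Minkowski functional $\|x\|_K=\min\{a\ge 0: x\in aK\}$ is continuous; it is origin-symmetric if $K=-K$. A convex body is a compact convex set with non-empty interior. The class $L_p^n$ of unit balls of $n$-dimensional subspaces of $L_p$ is, equivalently, the class of all centrally-symmetric convex bodies $D\subseteq\mathbb{R}^n$ for which there is a finite Borel measure $\nu_D$ on $S^{n-1}$ with $\|x\|_D^p=\int_{S^{n-1}}|(x,\theta)|^p\,d\nu_D(\theta)$ for all $x\in\mathbb{R}^n$. The Banach–Mazur distance from a star body $M$ to this class is $$d_{BM}(M,L_p^n)=\inf\{a\ge 1:\ \exists\, D\in L_p^n\text{ such that } D\subset M\subset aD\},$$ and $d_{BM}^{\,p}$ denotes its $p$-th power. *)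

(* Defs.v *)
From HB Require Import structures.
From mathcomp Require Import all_boot all_order all_algebra.
From mathcomp Require Import all_classical all_reals all_analysis.
From mathcomp Require Import measurable_realfun.

Set Implicit Arguments.
Unset Strict Implicit.
Unset Printing Implicit Defensive.

Import Order.TTheory GRing.Theory Num.Theory.
Import numFieldNormedType.Exports.

Local Open Scope classical_set_scope.
Local Open Scope ring_scope.


Fact rV_display : measure_display. Proof. exact: default_measure_display. Qed.

Section borel_rV.
Context {R : realType} {n : nat}.

Let borel : set (set 'rV[R]_n) := <<s open >>.

Let borel0 : borel set0.
Proof. exact: sigma_algebra0. Qed.

Let borelC A : borel A -> borel (~` A).
Proof. exact: sigma_algebraC. Qed.

Let borel_bigcup (F : (set 'rV[R]_n)^nat) :
  (forall i, borel (F i)) -> borel (\bigcup_i F i).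
Proof. exact: sigma_algebra_bigcup. Qed.

HB.instance Definition _ :=
  isMeasurable.Build rV_display 'rV[R]_n borel0 borelC borel_bigcup.

Lemma open_measurable_rV (U : set 'rV[R]_n) : open U -> measurable U.
Proof. exact: sub_gen_smallest. Qed.

End borel_rV.


Section measurable_rV.
Context {R : realType}.


Lemma measurable_rVP d (T : measurableType d) n (f : T -> 'rV[R]_n) :
  (forall i, measurable_fun setT (fun t => f t ord0 i)) ->
  measurable_fun setT f.
Proof.
move=> mf; apply: (@measurability _ _ _ _ setT f (@open (matrix R 1 n)) erefl) => _ [U oU <-].
rewrite setTI.
pose r (k : nat) : R := k.+1%:R^-1.
pose c (w : 'rV[rat]_n) : 'rV[R]_n := map_mx ratr w.
pose F (wk : 'rV[rat]_n * nat) : set T :=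
  if `[< ball (c wk.1) (r wk.2) `<=` U >]
  then f @^-1` ball (c wk.1) (r wk.2) else set0.
suff -> : f @^-1` U = \bigcup_wk F wk.
  apply: countable_bigcupT_measurable; first exact: countableP.
  case=> w k; rewrite /F/=; case: ifPn => // _.
  rewrite (_ : _ @^-1` _ =
      \bigcap_(i in [set: 'I_n]) (fun t => f t ord0 i) @^-1` ball (c w ord0 i) (r k)).
    apply: fin_bigcap_measurable => //= i _.
    by rewrite -[X in measurable X]setTI; apply: mf => //; exact: measurable_ball.
  apply/seteqP; split => t /=; first by move=> [_ h] i _; exact: h.
  move=> h; split; first by rewrite invr_gt0.
  by move=> i j; rewrite (ord1 i); exact: h.
apply/seteqP; split => t /=; last first.
  move=> [[w k] _]; rewrite /F/=; case: ifPn => // /asboolP; exact.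
move=> Uft; have /nbhs_ballP[e /= e0 eU] : nbhs (f t) U by exact: open_nbhs_nbhs.
have [k ke] : exists k, r k < e / 2.
  have [N _ hN] := near_infty_natSinv_lt (PosNum (divr_gt0 e0 (ltr0n R 2))).
  by exists N; exact: (hN N (leqnn N)).
have rk0 : 0 < r k by rewrite invr_gt0.
have H i : exists q : rat, `|f t ord0 i - ratr q| < r k.
  have /rat_in_itvoo[q] : f t ord0 i - r k < f t ord0 i + r k.
    by rewrite ltrD2l gtrN.
  by rewrite in_itv/= => hq; exists q; rewrite distrC ltr_distl.
have [q hq] := choice H.
have fb : ball (c (\row_i q i)) (r k) (f t).
  split => // i j; rewrite (ord1 i) !mxE /ball/= distrC; exact: hq.
exists (\row_i q i, k) => //; rewrite /F/= asboolT//.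
apply: subset_trans eU => y /= qy.
apply: (@le_ball _ _ _ (r k + r k)).
  by rewrite (splitr e) lerD// ltW.
by apply: ball_triangle qy; exact: ball_sym.
Qed.

Lemma continuous_measurable_rV n (g : 'rV[R]_n -> R) :
  continuous g -> measurable_fun setT g.
Proof.
move=> /continuousP cg.
apply: (@measurability _ _ _ _ setT g _ (RGenOpens.measurableE R)).
move=> _ [_ [a [b ->]] <-]; rewrite setTI.
by apply: open_measurable_rV; apply: cg; exact: interval_open.
Qed.

Lemma measurable_coord_rV n (i : 'I_n) :
  measurable_fun setT (fun u : 'rV[R]_n => u ord0 i).
Proof. by apply: continuous_measurable_rV => u; exact: coord_continuous. Qed.

End measurable_rV.

Section row_cons.
Context {R : realType} {n : nat}.

Definition row_cons (xv : R * 'rV[R]_n) : 'rV[R]_n.+1 :=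
  \row_i (if unlift ord0 i is Some j then xv.2 ord0 j else xv.1).

Definition row_uncons (u : 'rV[R]_n.+1) : R * 'rV[R]_n :=
  (u ord0 ord0, \row_j u ord0 (lift ord0 j)).

Lemma row_unconsK : cancel row_uncons row_cons.
Proof.
move=> u; apply/rowP => i; rewrite !mxE /=.
by case: unliftP => [j ->|->//]; rewrite mxE.
Qed.

Lemma row_consK : cancel row_cons row_uncons.
Proof.
move=> [x v]; congr pair; first by rewrite mxE unlift_none.
by apply/rowP => j; rewrite !mxE liftK.
Qed.

Lemma measurable_row_cons : measurable_fun setT row_cons.
Proof.
apply: measurable_rVP => i; under eq_fun do rewrite mxE.
case: unliftP => [j _|_] /=; last exact: measurable_fst.
exact: (measurableT_comp (measurable_coord_rV j) measurable_snd).
Qed.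

Lemma measurable_row_uncons : measurable_fun setT row_uncons.
Proof.
apply: measurable_fun_pair.
  exact: measurable_coord_rV.
apply: measurable_rVP => j; under eq_fun do rewrite mxE.
exact: measurable_coord_rV.
Qed.

End row_cons.

Section lebesgue_rV_succ.
Context {R : realType} {n : nat}.
Variable mu : {sigma_finite_measure set 'rV[R]_n -> \bar R}.
Local Open Scope ereal_scope.

Definition lebesgue_rV_succ : set 'rV[R]_n.+1 -> \bar R :=
  pushforward (lebesgue_measure \x mu) row_cons.

Let prod := (@lebesgue_measure R \x mu).

Let succ0 : lebesgue_rV_succ set0 = 0.
Proof. by rewrite /lebesgue_rV_succ /pushforward preimage_set0 measure0. Qed.

Let succ_ge0 A : 0 <= lebesgue_rV_succ A.
Proof. exact: (measure_ge0 prod). Qed.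

Let succ_sigma_additive : semi_sigma_additive lebesgue_rV_succ.
Proof.
have mpre A : measurable A -> measurable (row_cons @^-1` A : set (R * 'rV[R]_n)).
  by move=> mA; rewrite -[X in measurable X]setTI; exact: measurable_row_cons.
move=> F mF tF mUF; rewrite /lebesgue_rV_succ /pushforward preimage_bigcup.
apply: (@measure_semi_sigma_additive _ _ _ prod) => [i||].
- exact: mpre.
- apply/trivIsetP => /= i j _ _ ij; rewrite -preimage_setI.
  by move/trivIsetP : tF => /(_ _ _ _ _ ij) ->//; rewrite preimage_set0.
- by rewrite -preimage_bigcup; exact: mpre.
Qed.

HB.instance Definition _ := isMeasure.Build _ _ _ lebesgue_rV_succ
  succ0 succ_ge0 succ_sigma_additive.

Let succ_sigma_finite : sigma_finite setT lebesgue_rV_succ.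
Proof.
have /sigma_finiteP[F [TF ndF Foo]] := sigma_finiteT (@lebesgue_measure R).
have /sigma_finiteP[G [TG ndG Goo]] := sigma_finiteT mu.
exists (fun i => row_uncons @^-1` (F i `*` G i)).
  rewrite predeqE => u; split => // _.
  have [k _ Fk] : (\bigcup_i F i) (row_uncons u).1 by rewrite -TF.
  have [l _ Gl] : (\bigcup_i G i) (row_uncons u).2 by rewrite -TG.
  exists (maxn k l) => //; split.
    by move: Fk; exact/subsetPset/ndF/leq_maxl.
  by move: Gl; exact/subsetPset/ndG/leq_maxr.
move=> i; have [mF Foo_] := Foo i; have [mG Goo_] := Goo i.
have mFG : measurable (F i `*` G i) by exact: measurableX.
split.
  by rewrite -[X in measurable X]setTI; exact: measurable_row_uncons.
rewrite /lebesgue_rV_succ /pushforward -comp_preimage.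
rewrite (_ : _ \o _ = id); last by apply/funext => p; exact: row_consK.
by rewrite preimage_id product_measure1E// lte_mul_pinfty// ge0_fin_numE.
Qed.

HB.instance Definition _ :=
  Measure_isSigmaFinite.Build _ _ _ lebesgue_rV_succ succ_sigma_finite.

End lebesgue_rV_succ.

Fixpoint lebesgue_rV (R : realType) (n : nat) :
    {sigma_finite_measure set 'rV[R]_n -> \bar R} :=
  match n with
  | 0 => dirac (0 : 'rV[R]_0)
  | n'.+1 => lebesgue_rV_succ (lebesgue_rV R n')
  end.

(* [lebesgue_rV] is determined by its values on boxes. *)
Lemma lebesgue_rV_box (R : realType) (n : nat) (A : 'I_n -> set R) :
  (forall i, measurable (A i)) ->
  lebesgue_rV R n [set u : 'rV[R]_n | forall i, A i (u ord0 i)] =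
  (\prod_(i < n) lebesgue_measure (A i))%E.
Proof.
elim: n A => [|n IH] A mA /=.
  by rewrite big_ord0 diracE mem_set//; case.
pose B := [set v : 'rV[R]_n | forall i, A (lift ord0 i) (v ord0 i)].
have mB : measurable B.
  rewrite (_ : B = \bigcap_(i in [set: 'I_n])
      (fun v : 'rV[R]_n => v ord0 i) @^-1` A (lift ord0 i)); last first.
    by apply/seteqP; split => v /= h; [move=> i _; exact: h|move=> i; exact: h].
  apply: fin_bigcap_measurable => //= i _.
  by rewrite -[X in measurable X]setTI; exact: measurable_coord_rV.
rewrite big_ord_recl -(IH (fun i => A (lift ord0 i)))//.
rewrite -(product_measure1E lebesgue_measure (lebesgue_rV R n))//; last exact: mA.
congr product_measure1; apply/seteqP; split => -[x v] /=.
- move=> h; split => [|i]; first by have := h ord0; rewrite mxE unlift_none.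
  by have := h (lift ord0 i); rewrite mxE liftK.
- by move=> [hx hv] i; rewrite mxE; case: unliftP => [j ->|->] //; exact: hv.
Qed.


Section bodies.
Context {R : realType} {n : nat}.
Implicit Types (x y : 'rV[R]_n) (K M D : set 'rV[R]_n).

Definition dotv x y : R := \sum_(i < n) x ord0 i * y ord0 i.

(* The library norm on ['rV[R]_n] is the sup norm, hence the explicit
   Euclidean norm. *)
Definition unit_sphere : set 'rV[R]_n := [set x | Num.sqrt (dotv x x) = 1].

Definition dilate (a : R) K : set 'rV[R]_n := [set a *: x | x in K].

(* For a compact star-shaped [K] with the origin in its interior, this infimum
   is over a nonempty set and is attained. *)
Definition minkowski K x : R := inf [set a : R | 0 <= a /\ dilate a K x].

Definition star_shaped K : Prop :=
  forall x (t : R), K x -> 0 <= t -> t <= 1 -> K (t *: x).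

Definition star_body K : Prop :=
  [/\ compact K, star_shaped K, K° 0 & continuous (minkowski K)].

Definition origin_symmetric K : Prop := [set - x | x in K] = K.

Definition convex_body D : Prop :=
  [/\ compact D, convex_set (M := 'rV[R]_n) D & D° !=set0].

(* A finite Borel measure on the sphere is represented by a finite Borel measure
   on [R^n], of which only the restriction to the sphere is used. *)
Definition Lp_ball (p : R) D : Prop :=
  [/\ convex_body D, origin_symmetric D
    & exists nu : {finite_measure set 'rV[R]_n -> \bar R}, forall x,
        ((minkowski D x `^ p)%:E =
         \int[nu]_(theta in unit_sphere) (`|dotv x theta| `^ p)%:E)%E].

Definition dBM (M : set 'rV[R]_n) (p : R) : \bar R :=
  ereal_inf [set a%:E | a in
    [set a : R | 1 <= a /\
      exists D, [/\ Lp_ball p D, D `<=` M & M `<=` dilate a D]]].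

End bodies.

(* Main.v *)
(** Let [D] be an [L_p] ball with [D] inside [M] inside [aD], so that
    [|x|_M <= |x|_D <= a |x|_M].  Integrating the hypothesis against the measure
    representing [|x|_D^p] and exchanging integrals (Tonelli) gives
    [int_K |x|_D^p f <= int_M |x|_D^p f], hence
    [int_K |x|_M^p f <= a^p int_M |x|_M^p f].  As [|x|_M^p] is at most 1 on [M]
    and at least 1 off [M], this yields [int_K f <= a^p int_M f]; take the
    infimum over [a].  When [int_M f = 0], where the right-hand side is 0 even
    for an infinite distance, the hypothesis for a coordinate direction alone
    forces [int_K f = 0]. *)
Require Import Defs.
From mathcomp Require Import all_boot all_order all_algebra.
From mathcomp Require Import all_classical all_reals all_analysis.
From mathcomp Require Import measurable_realfun lra.

Set Implicit Arguments.
Unset Strict Implicit.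
Unset Printing Implicit Defensive.

Import Order.TTheory GRing.Theory Num.Theory.
Import numFieldNormedType.Exports.

Local Open Scope classical_set_scope.
Local Open Scope ring_scope.

(* Splitting off [A `&` B], where [g <= 1], the weight can be dropped on both
   sides because [c >= 1]. *)
Lemma weighted_comparison d (T : measurableType d) (R : realType)
    (mu : {measure set T -> \bar R}) (A B : set T) (f g : T -> R) (c : R)
    (mA : measurable A) (mB : measurable B)
    (f0 : forall x, 0 <= f x) (g0 : forall x, 0 <= g x)
    (mf : measurable_fun setT f) (mg : measurable_fun setT g)
    (gB : forall x, B x -> g x <= 1) (gB' : forall x, ~ B x -> 1 <= g x)
    (c1 : 1 <= c)
    (gAB : (\int[mu]_(x in A) (g x * f x)%:E <=
            c%:E * \int[mu]_(x in B) (g x * f x)%:E)%E) :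
  (\int[mu]_(x in A) (f x)%:E <= c%:E * \int[mu]_(x in B) (f x)%:E)%E.
Proof.
have c0 : 0 < c by lra.
pose gf x := g x * f x.
have gf0 x : 0 <= gf x by rewrite mulr_ge0.
have mF D : measurable_fun D (fun x => (f x)%:E).
  by apply: measurable_funTS; exact/measurable_EFinP.
have mG D : measurable_fun D (fun x => (gf x)%:E).
  by apply: measurable_funTS; apply/measurable_EFinP; exact: measurable_funM.
pose I h D : \bar R := (\int[mu]_(x in D) (h x : R)%:E)%E.
have I0 h D : (forall x, 0 <= h x) -> (0 <= I h D)%E.
  by move=> h0; apply: integral_ge0 => x _; rewrite lee_fin.
have splitI h C D : measurable C -> measurable D -> (forall x, 0 <= h x) ->
    measurable_fun C (fun x => (h x)%:E) ->
    I h C = (I h (C `&` D) + I h (C `\` D))%E.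
  move=> mC mD h0 mh; rewrite /I -ge0_integral_setU ?setUIDK//.
  - exact: measurableI.
  - exact: measurableD.
  - by move=> x _; rewrite lee_fin.
  - by apply/disj_setPS => x [[_ Dx] [_ /(_ Dx)]].
have mI : measurable (A `&` B) by exact: measurableI.
have mAB : measurable (A `\` B) by exact: measurableD.
have mBA : measurable (B `\` A) by exact: measurableD.
have leI h1 h2 D : measurable D -> (forall x, 0 <= h1 x) ->
    measurable_fun D (fun x => (h1 x)%:E) ->
    measurable_fun D (fun x => (h2 x)%:E) ->
    (forall x, D x -> h1 x <= h2 x) -> (I h1 D <= I h2 D)%E.
  move=> mD h0 m1 m2 h12; apply: ge0_le_integral => // x Dx; rewrite lee_fin//.
have gfle x : B x -> gf x <= f x by move=> Bx; rewrite ler_piMl// gB.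
have leAB : (I gf (A `&` B) <= I f (A `&` B))%E by apply: leI => // x [_ /gfle].
have leBA : (I gf (B `\` A) <= I f (B `\` A))%E by apply: leI => // x [/gfle].
have geAB : (I f (A `\` B) <= I gf (A `\` B))%E.
  by apply: leI => // x [_ nBx]; rewrite ler_peMl// gB'.
have {}gAB : (I gf A <= c%:E * I gf B)%E := gAB.
suff : (I f A <= c%:E * I f B)%E by [].
rewrite (splitI gf A B)// (splitI gf B A)// setIC in gAB.
rewrite (splitI f A B)// (splitI f B A)// setIC.
rewrite setIC in leAB.
move: (I0 gf (B `&` A) gf0) (I0 f (B `&` A) f0) (I0 gf (B `\` A) gf0).
move: (I0 f (B `\` A) f0) (I0 gf (A `\` B) gf0) (I0 f (A `\` B) f0).
move: (I gf (B `&` A)) (I f (B `&` A)) (I gf (A `\` B)) (I f (A `\` B))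
  (I gf (B `\` A)) (I f (B `\` A)) gAB leAB leBA geAB => {leI splitI I0}.
(* Infinite values make a premise false or the right-hand side [+oo]. With all six finite, [b <= gb
   <= (c - 1) * ga + c * gc <= (c - 1) * a + c * c'], where [1 <= c] is used in the last step. *)
case=> [ga| |] [a| |] [gb| |] [b| |] [gc| |] [c'| |] //=;
  rewrite ?addye ?addey ?gt0_muley ?leey// -?EFinD -?EFinM -?EFinD ?lee_fin//.
nra.
Qed.

(** * Tonelli on rectangles *)

(** Extending [h] by zero outside [A]*[S] reduces this to Tonelli on the whole product. *)
Lemma ge0_fubini_setX d1 d2 (T1 : measurableType d1) (T2 : measurableType d2)
    (R : realType) (m1 : {sigma_finite_measure set T1 -> \bar R})
    (m2 : {sigma_finite_measure set T2 -> \bar R}) (A : set T1) (S : set T2)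
    (h : T1 * T2 -> \bar R) (mA : measurable A) (mS : measurable S)
    (mh : measurable_fun setT h) (h0 : forall z, (0 <= h z)%E) :
  (\int[m1]_(x in A) \int[m2]_(y in S) h (x, y) =
   \int[m2]_(y in S) \int[m1]_(x in A) h (x, y))%E.
Proof.
pose H := h \_ (A `*` S).
have mH : measurable_fun setT H.
  apply/(measurable_restrictT h); first exact: measurableX.
  exact: measurable_funTS.
have H0 z : (0 <= H z)%E by apply: erestrict_ge0 => w _; exact: h0.
have HE := fubini_tonelli (m1 := m1) (m2 := m2) H mH H0.
rewrite integral_mkcond [in RHS]integral_mkcond.
transitivity (\int[m1]_x \int[m2]_y H (x, y))%E.
  apply: eq_integral => x _; rewrite patchE; case: ifPn => xA.
    rewrite integral_mkcond; apply: eq_integral => y _.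
    by rewrite /H !patchE in_setX/= xA.
  by rewrite integral0_eq// => y _; rewrite /H patchE in_setX/= (negbTE xA).
rewrite HE; apply: eq_integral => y _; rewrite patchE; case: ifPn => yS.
  rewrite [in RHS]integral_mkcond; apply: eq_integral => x _.
  by rewrite /H !patchE in_setX/= yS andbT.
by rewrite integral0_eq// => x _; rewrite /H patchE in_setX/= (negbTE yS) andbF.
Qed.

(** * Weights obtained by integrating a kernel, as [|x|_D^p] is from [|(x, theta)|^p] over the
    sphere *)

Section kernel_weight.
Context d1 d2 (T1 : measurableType d1) (T2 : measurableType d2) (R : realType).
Variables (m1 : {sigma_finite_measure set T1 -> \bar R})
  (m2 : {sigma_finite_measure set T2 -> \bar R}) (S : set T2)
  (k : T1 * T2 -> R) (g f : T1 -> R).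
Hypotheses (mS : measurable S) (mk : measurable_fun setT k)
  (k0 : forall z, 0 <= k z) (mf : measurable_fun setT f)
  (f0 : forall x, 0 <= f x)
  (gE : forall x, (g x)%:E = (\int[m2]_(y in S) (k (x, y))%:E)%E).

(** This provides the measurability of [|x|_D^p]: the definition of an [L_p] ball gives an integral
    formula for it rather than continuity. *)
Lemma measurable_kernel_weight : measurable_fun setT g.
Proof.
pose h := (EFin \o k) \_ (setT `*` S).
have mh : measurable_fun setT h.
  apply/(measurable_restrictT (EFin \o k)); first exact: measurableX.
  by apply: measurable_funTS; apply/measurable_EFinP.
have h0 z : (0 <= h z)%E by apply: erestrict_ge0 => w _; rewrite lee_fin.
have := measurable_fun_fubini_tonelli_F (m2 := m2) h mh h0.
rewrite (_ : fubini_F _ _ = EFin \o g) => [/measurable_EFinP//|].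
apply/funext => x; rewrite /fubini_F /= gE [in RHS]integral_mkcond.
by apply: eq_integral => y _; rewrite /h !patchE in_setX/= mem_set.
Qed.

Let h z := (k z * f z.1)%:E.

Let mh : measurable_fun setT h.
Proof.
apply/measurable_EFinP; apply: measurable_funM => //.
exact: (measurableT_comp mf measurable_fst).
Qed.

Let h0 z : (0 <= h z)%E.
Proof. by rewrite lee_fin mulr_ge0. Qed.

Lemma measurable_integral_kernel_weight (A : set T1) : measurable A ->
  measurable_fun setT (fun y => \int[m1]_(x in A) (k (x, y) * f x)%:E)%E.
Proof.
move=> mA; pose H := h \_ (A `*` setT).
have mH : measurable_fun setT H.
  apply/(measurable_restrictT h); first exact: measurableX.
  exact: measurable_funTS.
have H0 z : (0 <= H z)%E by apply: erestrict_ge0 => w _; exact: h0.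
have := measurable_fun_fubini_tonelli_G (m1 := m1) H mH H0.
rewrite (_ : fubini_G _ _ = fun y => \int[m1]_(x in A) (k (x, y) * f x)%:E)%E//.
apply/funext => y; rewrite /fubini_G [in RHS]integral_mkcond.
by apply: eq_integral => x _; rewrite /H !patchE in_setX/= [y \in _]mem_set//
  andbT.
Qed.

(** The factor [f x] is constant in [y], so it moves inside the inner integral before the order is
    exchanged. *)
Lemma integral_kernel_weight (A : set T1) : measurable A ->
  (\int[m1]_(x in A) (g x * f x)%:E =
   \int[m2]_(y in S) \int[m1]_(x in A) (k (x, y) * f x)%:E)%E.
Proof.
move=> mA; rewrite -(ge0_fubini_setX m1 m2 mA mS mh h0).
apply: eq_integral => x _; rewrite EFinM gE -ge0_integralZr//.
- apply/measurable_EFinP; apply: measurable_funTS.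
  exact: (measurableT_comp mk (measurable_pair1 x)).
- by move=> y _; rewrite lee_fin.
- by rewrite lee_fin.
Qed.

End kernel_weight.

(** * Weights vanishing on a null set *)

(** A nonnegative function has integral zero exactly when it vanishes almost everywhere, and off the
    null set where [w] is zero, [w x * f x] and [f x] have the same zeros. *)
Lemma integral_weight_eq0 d (T : measurableType d) (R : realType)
    (mu : {measure set T -> \bar R}) (A : set T) (f w : T -> R)
    (mA : measurable A) (f0 : forall x, 0 <= f x) (w0 : forall x, 0 <= w x)
    (mf : measurable_fun setT f) (mw : measurable_fun setT w)
    (w_null : mu (w @^-1` [set 0]) = 0%E) :
  (\int[mu]_(x in A) (w x * f x)%:E = 0 <-> \int[mu]_(x in A) (f x)%:E = 0)%E.
Proof.
have abs (h : T -> R) : (forall x, 0 <= h x) -> measurable_fun setT h ->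
    (\int[mu]_(x in A) (h x)%:E = 0)%E <-> ae_eq mu A (EFin \o h) (cst 0%E).
  move=> h0 mh; rewrite -ae_eq_integral_abs//; last first.
    by apply: measurable_funTS; apply/measurable_EFinP.
  rewrite (_ : (\int[mu]_(x in A) (h x)%:E)%E =
               (\int[mu]_(x in A) `|(EFin \o h) x|)%E)//.
  by apply: eq_integral => x _ /=; rewrite ger0_norm.
rewrite !abs//; last 2 first.
- by move=> x; rewrite mulr_ge0.
- exact: measurable_funM.
have wN : {ae mu, forall x, w x != 0}.
  exists (w @^-1` [set 0]); split => //.
    by rewrite -[X in measurable X]setTI; exact: mw.
  by move=> x /= /negP; rewrite negbK => /eqP.
split; last by apply: filterS => x /[apply] -[/= ->]; rewrite mulr0.
apply: filterS2 wN => x wx /[apply] -[/= /eqP].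
by rewrite mulf_eq0 (negbTE wx)/= => /eqP ->.
Qed.

(* The analysis library exports a lemma of the same name. *)
Local Notation minkowski := Defs.minkowski.

(** * Minkowski functionals and inclusions *)

Section bodies.
Context (R : realType) (n : nat).
Implicit Types (A B K M D : set 'rV[R]_n) (x : 'rV[R]_n) (f : 'rV[R]_n -> R).

(** As [t] decreases to 0, [t *: x] enters [A], and [a = t^-1] works. Since [inf] of the empty set
    is 0, lower bounds on [minkowski] rely on this nonemptiness. *)
Lemma absorbing_interior0 A x : A° 0 -> exists a, 0 <= a /\ dilate a A x.
Proof.
move=> A0.
have cx : t *: x @[t --> (0 : R)] --> (0 : 'rV[R]_n).
  by rewrite -[X in _ --> X](scale0r x); exact: scalel_continuous.
have tA : \forall t \near (0 : R), A (t *: x) := cx A A0.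
have [t [t0 Atx]] :=
  filter_ex (filterI (nbhs_right_gt (0 : R)) (cvg_within _ tA)).
exists t^-1; split; first by rewrite invr_ge0 ltW.
by exists (t *: x) => //; rewrite scalerA mulVf ?gt_eqF// scale1r.
Qed.

Let lb0 A x : has_lbound [set a : R | 0 <= a /\ dilate a A x].
Proof. by exists 0 => a []. Qed.

Lemma minkowski_ge0 A x : 0 <= minkowski A x.
Proof.
rewrite /minkowski; set E := [set _ | _].
have [->|/set0P E0] := eqVneq E set0; first by rewrite inf0.
by apply: lb_le_inf => // a [].
Qed.

Lemma minkowski_le1 A x : A x -> minkowski A x <= 1.
Proof.
by move=> Ax; apply: ge_inf => //; split => //; exists x; rewrite ?scale1r.
Qed.

(** If [x] were in [dilate a A] with [a < 1], star-shapedness would put [x] in [A]. *)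
Lemma minkowski_ge1 A x : star_shaped A -> A° 0 -> ~ A x -> 1 <= minkowski A x.
Proof.
move=> Astar A0 nAx; apply: lb_le_inf; first exact: absorbing_interior0.
move=> a [a0 [y Ay yx]]; rewrite leNgt; apply/negP => a1.
by apply: nAx; rewrite -yx; apply: Astar => //; exact: ltW.
Qed.

(** If [b] is admissible for [x] and [B], then [c * b] is admissible for [x] and [A]. *)
Lemma minkowski_le_dilate A B (c : R) x : B° 0 -> 0 < c -> B `<=` dilate c A ->
  minkowski A x <= c * minkowski B x.
Proof.
move=> B0 c0 BA; rewrite -ler_pdivrMl//.
apply: lb_le_inf; first exact: absorbing_interior0.
move=> b [b0 [y By yx]]; rewrite ler_pdivrMl//; apply: ge_inf => //.
split; first by rewrite mulr_ge0// ltW.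
have [z Az zy] := BA y By.
by exists z => //; rewrite mulrC -scalerA zy.
Qed.

Lemma minkowski_le_sub A B x : A° 0 -> A `<=` B ->
  minkowski B x <= minkowski A x.
Proof.
move=> A0 AB; rewrite -[leRHS]mul1r; apply: minkowski_le_dilate => // y Ay.
by exists y; [exact: AB|rewrite scale1r].
Qed.

(** A convex body is only assumed to have some interior point; for an [L_p] ball [D] with [M] inside
    [aD], this puts the origin in its interior. *)
Lemma interior0_undilate A B (c : R) : 0 < c -> A° 0 -> A `<=` dilate c B ->
  B° 0.
Proof.
move=> c0 A0 AB.
have cz : (c *: x : 'rV[R]_n) @[x --> (0 : 'rV[R]_n)] --> (0 : 'rV[R]_n).
  by rewrite -[X in _ --> X](scaler0 _ c); exact: scaler_continuous.
have cA : \forall x \near (0 : 'rV[R]_n), A (c *: x) := cz A A0.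
suff : \forall x \near (0 : 'rV[R]_n), B x by [].
apply: filterS cA => x /AB[y By].
by move=> /(scalerI (lt0r_neq0 c0)) <-.
Qed.

(** * Borel measurability of bodies, the sphere and the kernel *)

Lemma compact_measurable_rV A : compact A -> measurable A.
Proof.
move=> /(compact_closed (@norm_hausdorff R 'rV[R]_n)) cA.
rewrite -[A]setCK; apply: measurableC; apply: open_measurable_rV.
exact: closed_openC.
Qed.

Lemma measurable_dotv :
  measurable_fun setT (fun z : 'rV[R]_n * 'rV[R]_n => dotv z.1 z.2).
Proof.
apply: measurable_sum => i; apply: measurable_funM.
  exact: (measurableT_comp (measurable_coord_rV i) measurable_fst).
exact: (measurableT_comp (measurable_coord_rV i) measurable_snd).
Qed.

Lemma measurable_unit_sphere : measurable (@unit_sphere R n).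
Proof.
have md : measurable_fun setT (fun x : 'rV[R]_n => dotv x x).
  exact: (measurableT_comp measurable_dotv
    (measurable_fun_pair (@measurable_id _ _ setT) (@measurable_id _ _ setT))).
have ms : measurable_fun setT (@Num.sqrt R).
  by apply: continuous_measurable_fun; exact: sqrt_continuous.
have -> : @unit_sphere R n = (fun x => Num.sqrt (dotv x x)) @^-1` [set 1] by [].
by rewrite -[X in measurable X]setTI; exact: (measurableT_comp ms md).
Qed.

Lemma measurable_dotv_powR (p : R) : measurable_fun setT
  (fun z : 'rV[R]_n * 'rV[R]_n => `|dotv z.1 z.2| `^ p).
Proof.
apply: (measurableT_comp (measurable_powR p)).
exact: (measurableT_comp (@normr_measurable R setT) measurable_dotv).
Qed.

(** * Coordinate hyperplanes and directions *)

(** The hyperplane is a box with one side [[set 0]] and the others the whole line; the product of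
    lengths is 0 because [0 * +oo = 0]. *)
Lemma lebesgue_rV_coord0 (i : 'I_n) :
  lebesgue_rV R n [set x | x ord0 i = 0] = 0%E.
Proof.
pose A (j : 'I_n) : set R := if j == i then [set 0] else setT.
have Ai : A i = [set 0] by rewrite /A eqxx.
have := lebesgue_rV_box (A := A).
rewrite (bigD1 i)//= Ai lebesgue_measure_set1 mul0e => <-.
  congr (lebesgue_rV R n _); apply/seteqP; split=> x /=.
    by move=> xi j; rewrite /A; case: eqP => // ->.
  by move=> /(_ i); rewrite /A eqxx.
by move=> j; rewrite /A; case: ifP.
Qed.

Lemma unit_sphere_delta (i : 'I_n) : unit_sphere (delta_mx 0 i : 'rV[R]_n).
Proof.
rewrite /unit_sphere /= /dotv (bigD1 i)//= big1 => [|j ji].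
  by rewrite !mxE !eqxx mulr1 addr0 sqrtr1.
by rewrite !mxE (negbTE ji) andbF mulr0.
Qed.

Lemma dotv_delta (i : 'I_n) x : dotv x (delta_mx 0 i) = x 0 i.
Proof.
rewrite /dotv (bigD1 i)//= big1 => [|j ji].
  by rewrite mxE !eqxx mulr1 addr0.
by rewrite mxE (negbTE ji) andbF mulr0.
Qed.

Lemma star_body_measurable A : star_body A -> measurable A.
Proof. by case=> cA _ _ _; exact: compact_measurable_rV. Qed.

(** * Comparing the integrals over [K] and [M] *)

Section comparison.
Variables (K M : set 'rV[R]_n) (f : 'rV[R]_n -> R) (p : R).
Hypotheses (mK : measurable K) (mM : measurable M) (f_ge0 : forall x, 0 <= f x)
  (f_cont : continuous f)
  (KM : forall xi : 'rV[R]_n, unit_sphere xi ->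
      (\int[lebesgue_rV R n]_(x in K) (`|dotv x xi| `^ p * f x)%:E <=
       \int[lebesgue_rV R n]_(x in M) (`|dotv x xi| `^ p * f x)%:E)%E).

Let mf : measurable_fun setT f.
Proof. exact: continuous_measurable_rV. Qed.

Lemma integral_minkowski_Lp_ball_le D : Lp_ball p D ->
  (\int[lebesgue_rV R n]_(x in K) (minkowski D x `^ p * f x)%:E <=
   \int[lebesgue_rV R n]_(x in M) (minkowski D x `^ p * f x)%:E)%E.
Proof.
move=> [_ _ [nu nuE]].
have k0 (z : 'rV[R]_n * 'rV[R]_n) : 0 <= `|dotv z.1 z.2| `^ p.
  exact: powR_ge0.
have E A (mA : measurable A) :=
  integral_kernel_weight (lebesgue_rV R n) (m2 := nu) measurable_unit_sphere
    (measurable_dotv_powR p) k0 mf f_ge0 nuE mA.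
have mE A (mA : measurable A) := measurable_integral_kernel_weight
  (lebesgue_rV R n) (measurable_dotv_powR p) k0 mf f_ge0 mA.
rewrite !E//; apply: ge0_le_integral.
- exact: measurable_unit_sphere.
- by move=> xi _; apply: integral_ge0 => x _; rewrite lee_fin mulr_ge0//
    powR_ge0.
- by apply: measurable_funTS; exact: mE.
- by apply: measurable_funTS; exact: mE.
- exact: KM.
Qed.

Lemma integral_le_Lp_ball D (a : R) : star_body M -> 1 <= p -> 1 <= a ->
  Lp_ball p D -> D `<=` M -> M `<=` dilate a D ->
  (\int[lebesgue_rV R n]_(x in K) (f x)%:E <=
   (a `^ p)%:E * \int[lebesgue_rV R n]_(x in M) (f x)%:E)%E.
Proof.
move=> [_ Mstar M0 cM] p1 a1 LD DM MD.
have p0 : 0 <= p by lra.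
have one_p : 1 `^ p = 1 :> R by rewrite powR1.
have a0 : 0 < a by lra.
have D0 : D° 0 by exact: interior0_undilate MD.
have mpow : {in Num.nneg &, {homo (@powR R)^~ p : x y / x <= y}}.
  exact: ge0_ler_powR.
have mM' : measurable_fun setT (fun x => minkowski M x `^ p).
  apply: (measurableT_comp (measurable_powR p)).
  exact: continuous_measurable_rV.
have mD' : measurable_fun setT (fun x => minkowski D x `^ p).
  have [_ _ [nu nuE]] := LD.
  exact: (measurable_kernel_weight measurable_unit_sphere
    (measurable_dotv_powR p) (fun=> powR_ge0 _ _) nuE).
have mwf (w : 'rV[R]_n -> R) A : measurable_fun setT w ->
    measurable_fun A (fun x => (w x * f x)%:E).
  move=> mw; apply: measurable_funTS; apply/measurable_EFinP.
  exact: measurable_funM.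
(* The weight to be dropped is [|x|_M^p], with constant [a^p]. *)
apply: (@weighted_comparison _ _ _ _ _ _ _ (fun x => minkowski M x `^ p)) => //.
- by move=> x; exact: powR_ge0.
- move=> x Mx; rewrite -[leRHS]one_p; apply: mpow; rewrite ?nnegrE//.
    exact: minkowski_ge0.
  exact: minkowski_le1.
- move=> x nMx; rewrite -[leLHS]one_p; apply: mpow; rewrite ?nnegrE//.
    exact: minkowski_ge0.
  exact: minkowski_ge1.
- by rewrite -[leLHS]one_p; apply: mpow; rewrite ?nnegrE// ltW.
apply: (@le_trans _ _
  (\int[lebesgue_rV R n]_(x in K) (minkowski D x `^ p * f x)%:E)%E).
  apply: ge0_le_integral => //.
  - by move=> x _; rewrite lee_fin mulr_ge0// powR_ge0.
  - exact: mwf.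
  - exact: mwf.
  - move=> x _; rewrite lee_fin ler_wpM2r//; apply: mpow.
    + by rewrite nnegrE minkowski_ge0.
    + by rewrite nnegrE minkowski_ge0.
    + exact: minkowski_le_sub.
apply: (le_trans (integral_minkowski_Lp_ball_le LD)).
rewrite -ge0_integralZl_EFin//; last 3 first.
- by move=> x _; rewrite lee_fin mulr_ge0// powR_ge0.
- exact: mwf.
- exact: powR_ge0.
apply: ge0_le_integral => //.
- by move=> x _; rewrite lee_fin mulr_ge0// powR_ge0.
- exact: mwf.
- under eq_fun do rewrite -EFinM mulrA.
  by apply: mwf; exact: measurable_funM.
(* Here [a^p |x|_M^p] is regrouped as [(a |x|_M)^p], so that the inclusion of [M] in [aD]
   applies. *)
- move=> x _; rewrite -EFinM lee_fin mulrA ler_wpM2r//.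
  rewrite -powRM ?minkowski_ge0//; last exact: ltW.
  apply: mpow; rewrite ?nnegrE ?mulr_ge0 ?minkowski_ge0//; first exact: ltW.
  exact: minkowski_le_dilate.
Qed.

(** The weight [|x_i|^p] vanishes only on a null hyperplane, so on [K] and on [M] alike the
    integrals with and without it vanish together. No approximating [L_p] ball enters, so the
    conclusion holds even at infinite distance. *)
Lemma integral_eq0_le : K 0 -> M 0 -> 1 <= p ->
  (\int[lebesgue_rV R n]_(x in M) (f x)%:E = 0)%E ->
  (\int[lebesgue_rV R n]_(x in K) (f x)%:E = 0)%E.
Proof.
move=> K0 M0 p1 If0.
have p_neq0 : p != 0 by rewrite gt_eqF//; lra.
(* In dimension 0 there is no direction to choose, but [K] and [M] both equal the single point 0. *)
case: (pickP (fun i : 'I_n => true)) => [i _|no_i]; last first.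
  have all0 x : x = 0 by apply/rowP => i; have := no_i i.
  rewrite -If0; congr (integral _ _ _).
  by apply/seteqP; split => x _; rewrite (all0 x).
pose w x : R := `|dotv x (delta_mx 0 i)| `^ p.
have w0 x : 0 <= w x by exact: powR_ge0.
have mw : measurable_fun setT w.
  exact: (measurableT_comp (measurable_dotv_powR p) (measurable_pair2 _)).
have w_null : lebesgue_rV R n (w @^-1` [set 0]) = 0%E.
  rewrite -(lebesgue_rV_coord0 i); congr (lebesgue_rV R n _).
  apply/seteqP; split=> x /=; rewrite /w dotv_delta.
    by move=> /eqP; rewrite powR_eq0 normr_eq0 p_neq0 andbT => /eqP.
  by move=> ->; rewrite normr0 powR0.
apply/(integral_weight_eq0 mK f_ge0 w0 mf mw w_null).
apply/eqP; rewrite eq_le; apply/andP; split; last first.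
  by apply: integral_ge0 => x _; rewrite lee_fin mulr_ge0.
apply: (le_trans (KM (unit_sphere_delta i))).
by rewrite (integral_weight_eq0 mM f_ge0 w0 mf mw w_null).2.
Qed.

End comparison.
End bodies.

(** * Passing to the infimum over [a] *)

(** This keeps [dBM M p] to the power [p] positive, so that its product with [+oo] is [+oo]. *)
Lemma dBM_ge1 (R : realType) (n : nat) (M : set 'rV[R]_n) (p : R) :
  (1 <= dBM M p)%E.
Proof. by apply: le_ereal_inf_tmp => _ [a [a1 _] <-]; rewrite lee_fin. Qed.

Theorem theorem1p9 (R : realType) (n : nat) (K M : set 'rV[R]_n)
    (f : 'rV[R]_n -> R) (p : R)
    (K_star : star_body K) (K_sym : origin_symmetric K)
    (M_star : star_body M) (M_sym : origin_symmetric M)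
    (f_ge0 : forall x, 0 <= f x) (f_even : forall x, f (- x) = f x)
    (f_cont : continuous f) (p_ge1 : 1 <= p)
    (KM : forall xi : 'rV[R]_n, unit_sphere xi ->
      (\int[lebesgue_rV R n]_(x in K) (`|dotv x xi| `^ p * f x)%:E <=
       \int[lebesgue_rV R n]_(x in M) (`|dotv x xi| `^ p * f x)%:E)%E) :
  (\int[lebesgue_rV R n]_(x in K) (f x)%:E <=
   dBM M p `^ p * \int[lebesgue_rV R n]_(x in M) (f x)%:E)%E.
Proof.
have mK := star_body_measurable K_star.
have mM := star_body_measurable M_star.
have p0 : 0 < p by lra.
have bound a : (exists D, [/\ Lp_ball p D, D `<=` M & M `<=` dilate a D]) ->
    1 <= a -> (\int[lebesgue_rV R n]_(x in K) (f x)%:E <=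
   (a `^ p)%:E * \int[lebesgue_rV R n]_(x in M) (f x)%:E)%E.
  move=> [D [LD DM MD]] a1.
  exact: (integral_le_Lp_ball mK mM f_ge0 f_cont KM M_star p_ge1 a1 LD DM MD).
have int_eq0 : (\int[lebesgue_rV R n]_(x in M) (f x)%:E = 0)%E ->
    (\int[lebesgue_rV R n]_(x in K) (f x)%:E = 0)%E.
  apply: (integral_eq0_le mK mM f_ge0 f_cont KM) => //.
    by case: K_star => _ _ /interior_subset.
  by case: M_star => _ _ /interior_subset.
have k0 : (0 <= \int[lebesgue_rV R n]_(x in K) (f x)%:E)%E.
  by apply: integral_ge0 => x _; rewrite lee_fin.
have m0 : (0 <= \int[lebesgue_rV R n]_(x in M) (f x)%:E)%E.
  by apply: integral_ge0 => x _; rewrite lee_fin.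
move: (integral _ K _) (integral _ M _) k0 m0 bound int_eq0 => k m k0 m0 bound km0.
have d1 := dBM_ge1 M p.
have dp0 : (0 < dBM M p `^ p)%E by rewrite poweR_gt0//; exact: lt_le_trans d1.
(* The product with [m = 0] is 0 even when the distance is [+oo], so [k] itself must vanish. *)
have [m_eq0|m_neq0] := eqVneq m 0%E; first by rewrite m_eq0 mule0 km0.
have [->|m_fin] := eqVneq m +oo%E; first by rewrite gt0_muley ?leey.
have [d_inf|d_fin] := eqVneq (dBM M p) +oo%E.
  by rewrite d_inf poweRyr ?gt_eqF// gt0_mulye ?leey// lt0e m_neq0.
case: m m0 m_neq0 m_fin bound {km0} => // r r0 r_neq0 _ bound.
have {r0 r_neq0}r0 : 0 < r by rewrite lt0r -lee_fin r0 andbT.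
(* If [k] were [+oo] while [m] is finite, [bound] would exclude every admissible [a], making the
   distance [+oo]. *)
case: k k0 bound => [s||//] s0 bound; last first.
  have /negP[] := d_fin.
  apply/eqP/ereal_inf_pinfty.
  by move=> y [a [a1 aD] _]; have := bound a aD a1; rewrite -EFinM.
rewrite lee_fin in s0.
(* Solving [s <= a^p * r] for [a] gives [t <= a]. Thus [t] is a lower bound of the admissible [a],
   hence at most the infimum, and only then is the [p]-th power taken; no continuity of the power is
   required. *)
pose t := (s / r) `^ p^-1.
have sr0 : 0 <= s / r by rewrite divr_ge0// ltW.
have td : (t%:E <= dBM M p)%E.
  apply: le_ereal_inf_tmp => _ [a [a1 aD] <-]; have := bound a aD a1.
  rewrite -EFinM !lee_fin -ler_pdivrMr// => sra.
  rewrite -[leRHS]powRr1 ?(le_trans _ a1)// -(mulfV (lt0r_neq0 p0)) powRrM.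
  by apply: ge0_ler_powR; rewrite ?nnegrE ?invr_ge0 ?powR_ge0// ltW.
case: (dBM M p) d1 d_fin td {dp0} => [d||//] d1 // _.
rewrite !lee_fin in d1 *; move=> td.
rewrite -ler_pdivrMr//.
rewrite -[leLHS]powRr1// -(mulVf (lt0r_neq0 p0)) powRrM.
by apply: ge0_ler_powR; rewrite ?nnegrE ?powR_ge0// ?ltW//; lra.
Qed.
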